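(* Suppose $\sigma''=0$. Then the operators $\mathfrak{h}_2(s)=C_a^2\,\mathfrak{h}_1(s)+E\,I$, $$c(s)=C_bC_a\left(\sigma(s+1)-e^{-\partial_s}\nu(s)\right),\qquad c^+(s)=C_bC_a\left(\sigma(s+1)-\nu(s)\,e^{\partial_s}\right)$$ form a closed algebra, with the commutation relations $$[\mathfrak{h}_2(s),c(s)]=\tau' C_a^2\,c(s)+C_bC_a\,\sigma'(0)\left(\mathfrak{h}_2(s)-\tau' C_a^2-E\right),$$ $$[\mathfrak{h}_2(s),c^+(s)]=-\tau' C_a^2\,c^+(s)-C_bC_a\,\sigma'(0)\left(\mathfrak{h}_2(s)-\tau' C_a^2-E\right),$$ $$[c(s),c^+(s)]=C_b^2\left[-\tau' C_a^2\,\sigma(s)-\sigma'(0)\left(\mathfrak{h}_2(s)-E\right)\right].$$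
   Context: Here $\sigma$ and $\tau$ are the coefficients of the hypergeometric-type difference equation on the uniform lattice, $\sigma(s)\Delta\nabla y(s)+\tau(s)\Delta y(s)+\lambda y(s)=0$, where $\Delta f(s)=f(s+1)-f(s)$ and $\nabla f(s)=f(s)-f(s-1)$; in general $\sigma$ is a polynomial of degree at most $2$ and $\tau$ a polynomial of degree $1$ with constant derivative $\tau'$. $C_a,C_b,E$ are constants. Put $\nu(s)=\sqrt{\sigma(s+1)[\sigma(s)+\tau(s)]}$ and $$\mathfrak{h}_1(s)=-\nu(s-1)\,e^{-\partial_s}-\nu(s)\,e^{\partial_s}+[2\sigma(s)+\tau(s)]I,$$ where $e^{\alpha\partial_s}f(s)=f(s+\alpha)$ and $I$ is the identity operator. In operator expressions, functions of $s$ act by multiplication, constants stand for multiples of $I$, products are compositions (so $e^{-\partial_s}\nu(s)=\nu(s-1)e^{-\partial_s}$), and $[A,B]=AB-BA$. Identities are between formal difference operators, with $\sqrt f\,\sqrt f=f$. (Equivalently, $\mathfrak{h}_2(s)=b(s)b^+(s)+(\tau'-\sigma'')C_a^2+E$ with $b(s)=C_a\big(\sqrt{\sigma(s+1)}\,e^{\frac12\partial_s}-\sqrt{\sigma(s-1)+\tau(s-1)}\,e^{-\frac12\partial_s}\big)$, $b^+(s)=C_a\big(e^{-\frac12\partial_s}\sqrt{\sigma(s+1)}-e^{\frac12\partial_s}\sqrt{\sigma(s-1)+\tau(s-1)}\big)$, and $c(s)=C_b\,b(s)e^{-\frac12\partial_s}\sqrt{\sigma(s+1)}$, $c^+(s)=C_b\sqrt{\sigma(s+1)}\,e^{\frac12\partial_s}b^+(s)$.)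 ''Closed algebra'' refers to the commutators being given by the displayed relations. *)

(* Defs.v *)
From HB Require Import structures.
From mathcomp Require Import all_boot all_order all_algebra.
From mathcomp Require Import boolp functions.

Set Implicit Arguments.
Unset Strict Implicit.
Unset Printing Implicit Defensive.

Import Order.TTheory GRing.Theory Num.Theory.
Local Open Scope ring_scope.

(* Difference operators are maps on all functions [K -> K] ([K^o] is [K] as a
   vector space over itself).  Their sums,
   differences and scalings are the pointwise ones of
   mathcomp.classical.functions.  The product of operators is the composition
   [\o]; the ring product [*] on this type is the pointwise one and must not be
   used for it.  A constant [k] seen as an operator is [k *: id]. *)
Definition operator (K : numFieldType) := (K -> K^o) -> (K -> K^o).

Section Operators.
Variable K : numFieldType.
Implicit Types (f nu : K -> K) (A B : operator K) (sigma tau : {poly K}).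

Definition mulop f : operator K := fun y s => f s * y s.

(* exp(a d/ds) *)
Definition shift (a : K) : operator K := fun y s => y (s + a).

Definition commutator A B : operator K := (A \o B) - (B \o A).

(* [nu] is a formal square root of [f]: no branch is prescribed, and the choice
   of sign may vary from point to point. *)
Definition is_sqrt nu f : Prop := forall s, nu s * nu s = f s.

Definition nu_radicand sigma tau : K -> K :=
  fun s => sigma.[s + 1] * (sigma.[s] + tau.[s]).

Definition h1 sigma tau nu : operator K :=
  - (mulop (fun s => nu (s - 1)) \o shift (- 1)) - (mulop nu \o shift 1)
  + mulop (fun s => 2 * sigma.[s] + tau.[s]).

Definition h2 sigma tau nu (Ca E : K) : operator K :=
  Ca ^+ 2 *: h1 sigma tau nu + E *: (id : operator K).

Definition c_op sigma nu (Ca Cb : K) : operator K :=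
  (Cb * Ca) *: (mulop (fun s => sigma.[s + 1]) - (shift (- 1) \o mulop nu)).

Definition c_plus sigma nu (Ca Cb : K) : operator K :=
  (Cb * Ca) *: (mulop (fun s => sigma.[s + 1]) - (mulop nu \o shift 1)).

End Operators.

(* Over the complex numbers the principal root is an admissible [nu]. *)
Lemma is_sqrt_sqrtC (C : numClosedFieldType) (f : C -> C) :
  is_sqrt (fun s => sqrtC (f s)) f.
Proof. by move=> s; rewrite -expr2 sqrtCK. Qed.

(* Main.v *)
Require Import Defs.
From HB Require Import structures.
From mathcomp Require Import all_boot all_order all_algebra.
From mathcomp Require Import boolp functions ring.

Set Implicit Arguments.
Unset Strict Implicit.
Unset Printing Implicit Defensive.

Import Order.TTheory GRing.Theory Num.Theory.
Local Open Scope ring_scope.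

(** Write [A] for [exp(-d/ds) nu], [B] for [nu exp(d/ds)], [S] for
multiplication by [sigma(s + 1)] and [D] for multiplication by
[2 sigma + tau], so that [h1 = - A - B + D] and, up to the factor [Cb Ca],
[c = S - A] and [c^+ = S - B].  When [sigma'' = 0] both [sigma] and [tau] are
affine, hence a shift changes them by a constant only, and

- [AS - SA = - sigma'(0) A] and [BS - SB = sigma'(0) B];
- [DA - AD = (2 sigma'(0) + tau') A] and [DB - BD = - (2 sigma'(0) + tau') B].

The product of shifts [B A] is multiplication by [nu(s)^2] and [A B] is
multiplication by [nu(s - 1)^2], so that [BA - AB] is multiplication by the
backward difference of the radicand of [nu].  That difference is the only
place where a quadratic expression could survive, and it is
[sigma'(0) (2 sigma + tau) + tau' sigma] ([nu_radicand_nabla]).  In the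
commutator of [h1] with [S - A], the first term completes [- sigma'(0) (A + B)]
to [sigma'(0) h1], and the second one combines with [- tau' A] into
[tau' (S - A)], up to a constant.  The other two commutators have the same
ingredients, which is why they also close on [h2], [c], [c^+] and [sigma].

The operators are compared through their values at a function and a point;
products of neighbouring values of [nu] never need to be known, because the
double shifts [A A] and [B B] cancel in the commutators and only squares of a
value of [nu] remain. *)

(** The coefficients of [p^`(n)] are those of [p] from degree [n] on, times
integers that are nonzero in characteristic zero. *)
Lemma derivn_eq0_size (K : numFieldType) (p : {poly K}) n :
  p^`(n) = 0 -> (size p <= n)%N.
Proof.
move=> dp0; apply/leq_sizeP => j le_nj.
have := coef_derivn n p (j - n); rewrite dp0 coef0 subnKC // => /esym/eqP.
by rewrite mulrn_eq0 -leqn0 leqNgt ffact_gt0 le_nj => /eqP.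
Qed.

Lemma horner_affineD (R : comNzRingType) (p : {poly R}) (s a : R) :
  (size p <= 2)%N -> p.[s + a] = p.[s] + p^`().[0] * a.
Proof.
move=> p_le2; rewrite horner_coef0 coef_deriv mulr1n.
rewrite !(horner_coef_wide _ p_le2) !big_ord_recl !big_ord0 /=.
by rewrite /bump /=; ring.
Qed.

(** The quadratic parts of the two values cancel, which leaves a linear
combination of [sigma] and [2 sigma + tau], the potential of [h1]. *)
Lemma nu_radicand_nabla (K : numFieldType) (sigma tau : {poly K}) (s : K) :
  (size sigma <= 2)%N -> (size tau <= 2)%N ->
  nu_radicand sigma tau s - nu_radicand sigma tau (s - 1) =
    sigma^`().[0] * (2 * sigma.[s] + tau.[s]) + tau^`().[0] * sigma.[s].
Proof.
move=> sigma_le2 tau_le2; rewrite /nu_radicand subrK !horner_affineD //; ring.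
Qed.

Theorem theorem5p1 (K : numFieldType) (sigma tau : {poly K}) (nu : K -> K)
    (Ca Cb E : K)
    (sigma_deg : (size sigma <= 3)%N)
    (tau_deg : size tau = 2%N)
    (nuE : is_sqrt nu (nu_radicand sigma tau))
    (sigma2_eq0 : sigma^`(2) = 0) :
  let dtau := tau^`().[0] in
  let dsigma0 := sigma^`().[0] in
  let H := h2 sigma tau nu Ca E in
  let c := c_op sigma nu Ca Cb in
  let cp := c_plus sigma nu Ca Cb in
  let I := (id : operator K) in
  [/\ commutator H c =
        (dtau * Ca ^+ 2) *: c
        + (Cb * Ca * dsigma0) *: (H - (dtau * Ca ^+ 2) *: I - E *: I),
      commutator H cp =
        - ((dtau * Ca ^+ 2) *: cp)
        - (Cb * Ca * dsigma0) *: (H - (dtau * Ca ^+ 2) *: I - E *: I)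
    & commutator c cp =
        Cb ^+ 2 *: (- ((dtau * Ca ^+ 2) *: mulop (horner sigma))
                    - dsigma0 *: (H - E *: I))].
Proof.
move=> dtau dsigma0 H c cp I.
have sigma_le2 : (size sigma <= 2)%N by exact: derivn_eq0_size.
have tau_le2 : (size tau <= 2)%N by rewrite tau_deg.
have nu2_pred s : nu (s - 1) * nu (s - 1) = nu s * nu s
    - (dsigma0 * (2 * sigma.[s] + tau.[s]) + dtau * sigma.[s]).
  by rewrite !nuE -nu_radicand_nabla // subKr.
have sigmaD s a : sigma.[s + a] = sigma.[s] + dsigma0 * a.
  exact: horner_affineD.
have tauD s a : tau.[s + a] = tau.[s] + dtau * a.
  exact: horner_affineD.
split; apply/funext => y; apply/funext => s.
all: have nu2 := nu2_pred s.
all: rewrite /commutator /H /c /cp /I /h2 /c_op /c_plus /h1 /mulop /shift.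
all: rewrite !fctE /GRing.scale /= ?addrK ?subrK ?sigmaD ?tauD.
all: ring: nu2.
Qed.
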